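(* A magma with inverses satisfying the Moufang identity (M1) $((x\cdot y)\cdot x)\cdot z = x\cdot (y\cdot (x\cdot z))$ or the Moufang identity (M2) $x\cdot (y\cdot (z\cdot y)) = ((x\cdot y)\cdot z)\cdot y$ (for all $x,y,z$) is a Moufang loop. Thus, Moufang loops are defined equationally by $$x\cdot 1 = 1\cdot x = x,\quad x\cdot x^{-1} = x^{-1}\cdot x = 1,\quad ((x\cdot y)\cdot x)\cdot z = x\cdot (y\cdot (x\cdot z)),$$ or by $$x\cdot 1 = 1\cdot x = x,\quad x\cdot x^{-1} = x^{-1}\cdot x = 1,\quad x\cdot (y\cdot (z\cdot y)) = ((x\cdot y)\cdot z)\cdot y,$$ that is, for each of these two systems, a set $M$ with a binary operation $\cdot$ and an element $1\in M$ is a Moufang loop with neutral element $1$ if and only if there is a unary operation $x\mapsto x^{-1}$ on $M$ such that the identities of the system hold for all $x,y,z\in M$.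
   Context: A magma here is a set with a single binary operation $\cdot$ possessing a two-sided neutral element $1$. A magma $M$ is with inverses if for every $x\in M$ there is $y\in M$ satisfying $x\cdot y = y\cdot x = 1$ (such $y$ is not assumed unique). A loop is a magma in which every equation $x\cdot y = z$ has a unique solution whenever two of the elements $x,y,z$ are specified; equivalently, all left translations $y\mapsto x\cdot y$ and all right translations $y\mapsto y\cdot x$ are bijections. A Moufang loop is a loop satisfying any one of the following four identities, which are known to be equivalent for loops: (M1) $((x\cdot y)\cdot x)\cdot z = x\cdot (y\cdot (x\cdot z))$; (M2) $x\cdot (y\cdot (z\cdot y)) = ((x\cdot y)\cdot z)\cdot y$; (M3) $(x\cdot y)\cdot (z\cdot x) = x\cdot ((y\cdot z)\cdot x)$; (M4) $(x\cdot y)\cdot (z\cdot x) = (x\cdot (y\cdot z))\cdot x$. *)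

(* Defs.v *)
From mathcomp Require Import ssreflect ssrfun ssrbool monoid.

Set Implicit Arguments.
Unset Strict Implicit.
Unset Printing Implicit Defensive.

Local Open Scope group_scope.

(* [baseUMagmaType] is a bare type with a binary operation and a distinguished
   element 1, subject to no axiom (nor to decidable equality or choice, unlike
   [umagmaType]); that 1 is neutral is stated by [neutral_one]. *)
Definition neutral_one (M : baseUMagmaType) : Prop :=
  forall x : M, x * 1 = x /\ 1 * x = x.

Definition magma_with_inverses (M : baseUMagmaType) : Prop :=
  neutral_one M /\ forall x : M, exists y : M, x * y = 1 /\ y * x = 1.

(* When x and y are the specified elements, unique solvability of x * y = z
   holds in every magma. *)
Definition loop (M : baseUMagmaType) : Prop :=
  [/\ neutral_one M,
      forall x z : M, exists! y : M, x * y = z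
    & forall y z : M, exists! x : M, x * y = z].

Definition moufang1 (M : baseUMagmaType) : Prop :=
  forall x y z : M, ((x * y) * x) * z = x * (y * (x * z)).

Definition moufang2 (M : baseUMagmaType) : Prop :=
  forall x y z : M, x * (y * (z * y)) = ((x * y) * z) * y.

Definition moufang3 (M : baseUMagmaType) : Prop :=
  forall x y z : M, (x * y) * (z * x) = x * ((y * z) * x).

Definition moufang4 (M : baseUMagmaType) : Prop :=
  forall x y z : M, (x * y) * (z * x) = (x * (y * z)) * x.

Definition moufang_loop (M : baseUMagmaType) : Prop :=
  loop M /\ [\/ moufang1 M, moufang2 M, moufang3 M | moufang4 M].

(* Main.v *)
Require Import Defs.
From Stdlib Require Import IndefiniteDescription.
From HB Require Import structures.
From mathcomp Require Import ssreflect ssrfun ssrbool monoid.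

Local Open Scope group_scope.

(** Write [L x] for the left translation by [x]. Identity (M1) says that
    [L x \o L y \o L x] is again a left translation, and since [L u] maps 1 to
    [u], it is the left translation by its value at 1. If [a] and [b] are
    mutually inverse, then [L b \o L b] = [L (b * b)], and
    [L a \o L b \o L b \o L a] is the left translation by its value at 1, which
    is 1; so it is the identity. On the other hand (M1) with [a * b = 1] gives
    [L a \o L b \o L a = L a], so [L a \o L b] is idempotent; being onto, it is
    the identity. This is the left inverse property ([moufang1_lip]). Cancelling
    in (M1) then yields the right inverse property ([moufang1_rip]), and the two
    inverse properties make all translations bijective ([ip_loop]).

    Conversely, a loop satisfying any of the four identities has two-sided
    inverses and both inverse properties, and under the inverse properties the
    four identities follow from one another: inversion is an antiautomorphism,
    hence it turns (M1) into (M2), and solving [u * v = w] as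
    [w * i v = u] turns (M4) into (M1).

    The opposite magma exchanges (M1) with (M2) and (M3) with (M4), which halves
    the work. Neutral elements, loops and inverse operations are the same in a
    magma and in its opposite. *)

(** * The opposite magma *)

Definition opposite (M : Type) : Type := M.

HB.instance Definition _ (M : baseUMagmaType) :=
  hasMul.Build (opposite M) (fun x y : M => y * x).
HB.instance Definition _ (M : baseUMagmaType) :=
  hasOne.Build (opposite M) (1 : M).

Lemma neutral_opposite (M : baseUMagmaType) :
  neutral_one M -> neutral_one (opposite M).
Proof. by move=> one x; have [x1 onex] := one x; split. Qed.

Lemma loop_opposite (M : baseUMagmaType) : loop M -> loop (opposite M).
Proof.
case=> one divl divr; split; first exact: neutral_opposite.
- by move=> x z; apply: divr.
- by move=> y z; apply: divl.
Qed.

Lemma moufang1_opposite (M : baseUMagmaType) :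
  moufang2 M -> moufang1 (opposite M).
Proof. by move=> m2 x y z; apply: (m2 z x y). Qed.

Lemma moufang1_of_opposite (M : baseUMagmaType) :
  moufang2 (opposite M) -> moufang1 M.
Proof. by move=> m2 x y z; apply: (m2 z x y). Qed.

(** * Inverse properties *)

Section InverseProperties.
Variable M : baseUMagmaType.
Implicit Type i : M -> M.

Definition two_sided_inverse i := forall x : M, x * i x = 1 /\ i x * x = 1.

Definition left_inverse_property i :=
  forall x y : M, i x * (x * y) = y /\ x * (i x * y) = y.

Definition right_inverse_property i :=
  forall x y : M, (y * x) * i x = y /\ (y * i x) * x = y.

Lemma magma_with_inversesP :
  magma_with_inverses M -> exists i, two_sided_inverse i.
Proof. by case=> _ /functional_choice. Qed.

Lemma ip_loop i :
    neutral_one M -> left_inverse_property i -> right_inverse_property i ->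
  loop M.
Proof.
move=> one lip rip; split=> // x z.
- exists (i x * z); split=> [|y <-]; first by have [_ ->] := lip x z.
  by have [-> _] := lip x y.
- exists (z * i x); split=> [|y <-]; first by have [_ ->] := rip x z.
  by have [-> _] := rip x y.
Qed.

Lemma ip_two_sided i :
    neutral_one M -> left_inverse_property i -> right_inverse_property i ->
  two_sided_inverse i.
Proof.
move=> one lip rip x; have [xix _] := rip x 1; have [ixx _] := lip x 1.
by move: xix ixx; rewrite (one x).1 (one x).2.
Qed.

Lemma lip_involutive i :
    neutral_one M -> two_sided_inverse i -> left_inverse_property i ->
  involutive i.
Proof.
move=> one inv lip x; have [] := lip (i x) x.
by rewrite (inv x).2 (one _).1.
Qed.

Lemma ip_antimorphism i :
    neutral_one M -> left_inverse_property i -> right_inverse_property i ->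
  forall x y : M, i (x * y) = i y * i x.
Proof.
move=> one lip rip x y; set s := x * y.
(* [s = x * y] is solved for [y], then for [i x], then for [i s]. *)
have ys : i x * s = y by have [] := lip x y.
have xs : y * i s = i x by rewrite -ys; have [] := rip s (i x).
by rewrite -xs; have [-> _] := lip y (i s).
Qed.

(** * From the Moufang identities to the inverse properties *)

(** The two products [L a \o L b] and [L b \o L a] compose to the identity, by
    evaluation at 1, and each is idempotent, so each is the identity. *)
Lemma moufang1_lip i :
    neutral_one M -> two_sided_inverse i -> moufang1 M ->
  left_inverse_property i.
Proof.
move=> one inv m1.
have cancel_inv (a b z : M) : a * b = 1 -> b * a = 1 -> a * (b * z) = z.
  move=> ab ba.
  have LbLb (t : M) : b * (b * t) = (b * b) * t.
    by have := m1 b 1 t; rewrite (one b).1 (one (b * t)).2.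
  have LaLbLa (t : M) : a * (b * (a * t)) = a * t.
    by rewrite -m1 ab (one a).2.
  have LaLbLbLa (t : M) : a * (b * (b * (a * t))) = t.
    rewrite LbLb -m1.
    have -> : (a * (b * b)) * a = 1.
      by rewrite -[_ * a](one _).1 m1 (one a).1 -LbLb ba (one b).1.
    by rewrite (one t).2.
  (* [z] is in the image of the idempotent [L a \o L b]. *)
  by rewrite -{1}(LaLbLbLa z) LaLbLa LaLbLbLa.
by move=> x y; split; apply: cancel_inv; have [] := inv x.
Qed.

(** The inverse of [L x \o L y \o L x = L ((x * y) * x)] can be written in two
    ways, so [i ((x * y) * x) = (i x * i y) * i x]; cancelling this against
    [((x * y) * x) * (i x * i y) = x] gives [((i x * i y) * i x) * x = i x * i y],
    where [i x * i y] is arbitrary. *)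
Lemma moufang1_rip i :
    neutral_one M -> two_sided_inverse i -> moufang1 M ->
  right_inverse_property i.
Proof.
move=> one inv m1; have lip := moufang1_lip i one inv m1.
have invK := lip_involutive i one inv lip.
have inv_unique (u v : M) : u * v = 1 -> v = i u.
  by move=> uv; rewrite -[v](lip u v).1 uv (one _).1.
have divK (x p : M) : (p * i x) * x = p.
  have [y ->] : exists y, p = i x * i y.
    by exists (i (x * p)); rewrite invK (lip x p).1.
  have -> : (i x * i y) * i x = i ((x * y) * x).
    apply: inv_unique; rewrite m1.
    have -> : x * ((i x * i y) * i x) = i y * i x.
      have := m1 (i x) (i y) 1; rewrite !(one _).1 => ->.
      by rewrite (lip x _).2.
    by rewrite (lip y _).2 (inv x).1.
  have qp : ((x * y) * x) * (i x * i y) = x.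
    by rewrite m1 (lip x _).2 (inv y).1 (one x).1.
  by have [+ _] := lip ((x * y) * x) (i x * i y); rewrite qp.
by move=> x y; split; [rewrite -{1}[x]invK|]; apply: divK.
Qed.

(** Inversion is an antiautomorphism, and it exchanges (M1) and (M2). *)
Lemma moufang1_moufang2 i :
    neutral_one M -> left_inverse_property i -> right_inverse_property i ->
  moufang1 M -> moufang2 M.
Proof.
move=> one lip rip m1 x y z.
have invM := ip_antimorphism i one lip rip.
have invK := lip_involutive i one (ip_two_sided i one lip rip) lip.
have /(congr1 i) := m1 (i y) (i z) (i x).
by rewrite !invM !invK.
Qed.

Lemma moufang1_loop_inverses :
  loop M -> moufang1 M -> magma_with_inverses M.
Proof.
case=> one divl _ m1; split=> // x; have [y [xy _]] := divl x 1.
exists y; split=> //; have [w [_ w_unique]] := divl x x.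
(* (M1) with [x * y = 1] and [z = 1] reads [x = x * (y * x)]. *)
rewrite -(w_unique 1 (one x).1); symmetry; apply: w_unique.
by have := m1 x y 1; rewrite xy !(one _).1 (one x).2.
Qed.

(** * From the third and fourth identities to the first two *)

(** Either identity contains the flexible law (take [z = 1], respectively
    [y = 1]), which says that their right-hand sides agree. *)
Lemma moufang34 : neutral_one M -> moufang3 M <-> moufang4 M.
Proof.
move=> one; split=> [m3 x y z|m4 x y z].
  have flex (u v : M) : (u * v) * u = u * (v * u).
    by have := m3 u v 1; rewrite (one u).2 (one v).1.
  by rewrite m3 flex.
have flex (u v : M) : u * (v * u) = (u * v) * u.
  by have := m4 u 1 v; rewrite (one u).1 (one v).2.
by rewrite m4 flex.
Qed.

(** With [y] the right inverse of [x], (M4) reads [z * x = (x * (y * z)) * x],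
    and [x] cancels; with [z] the left inverse of [x], (M3) reads
    [x * y = x * ((y * z) * x)], and [x] cancels. *)
Lemma moufang3_ip :
    loop M -> moufang3 M ->
  exists i, left_inverse_property i /\ right_inverse_property i.
Proof.
move=> [one divl divr] m3; have m4 := (moufang34 one).1 m3.
have cancell (x u v : M) : x * u = x * v -> u = v.
  have [w [_ w_unique]] := divl x (x * v).
  by move=> /w_unique <-; apply: w_unique.
have cancelr (x u v : M) : u * x = v * x -> u = v.
  have [w [_ w_unique]] := divr x (v * x).
  by move=> /w_unique <-; apply: w_unique.
have lcancel_inv (x y z : M) : x * y = 1 -> x * (y * z) = z.
  by move=> xy; apply: (cancelr x); rewrite -m4 xy (one _).2.
have rcancel_inv (x y z : M) : z * x = 1 -> (y * z) * x = y.
  by move=> zx; apply: (cancell x); rewrite -m3 zx (one _).1.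
have [i inv] : exists i, two_sided_inverse i.
  apply: magma_with_inversesP; split=> // x.
  have [y [xy _]] := divl x 1; exists y; split=> //.
  by apply: (cancell x); rewrite lcancel_inv // (one x).1.
exists i; split=> x y; have [xix ixx] := inv x.
- by split; apply: lcancel_inv.
- by split; apply: rcancel_inv.
Qed.

(** By (M4), [(x * y) * (z * x) = (x * c) * x] for [c = y * z]. Moving the right
    factors of both this equation and [c = y * z] to the other side gives
    [((x * c) * x) * (i x * i z) = x * (c * i z)], which is (M1) with [i z] in
    the form [x * t]. *)
Lemma moufang4_moufang1 i :
    neutral_one M -> left_inverse_property i -> right_inverse_property i ->
  moufang4 M -> moufang1 M.
Proof.
move=> one lip rip m4 x c t.
have invM := ip_antimorphism i one lip rip.
have invK := lip_involutive i one (ip_two_sided i one lip rip) lip.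
set z := i (x * t); have iz : i z = x * t by rewrite /z invK.
have <- : i (z * x) = t by rewrite invM iz (lip x t).1.
rewrite invM iz (lip x t).1.
have := m4 x (c * i z) z; rewrite (rip z c).2 => <-.
have -> : z * x = i t by rewrite -[z * x]invK invM iz (lip x t).1.
by rewrite (rip t _).2 iz.
Qed.

End InverseProperties.

(** * Moufang loops are defined equationally *)

Lemma moufang1_magma_loop (M : baseUMagmaType) :
  magma_with_inverses M -> moufang1 M -> loop M.
Proof.
move=> minv m1; have one := minv.1.
have [i inv] := magma_with_inversesP _ minv.
exact: (ip_loop _ i one (moufang1_lip _ i one inv m1)
                        (moufang1_rip _ i one inv m1)).
Qed.

Lemma magma_with_inverses_opposite (M : baseUMagmaType) :
  magma_with_inverses M -> magma_with_inverses (opposite M).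
Proof.
case=> one inv; split; first exact: neutral_opposite.
by move=> x; have [y [xy yx]] := inv x; exists y.
Qed.

Lemma moufang_magma_loop (M : baseUMagmaType) :
  magma_with_inverses M -> moufang1 M \/ moufang2 M -> moufang_loop M.
Proof.
move=> minv [m1|m2].
  by split; [apply: moufang1_magma_loop | apply: Or41].
split; last exact: Or42.
apply: (loop_opposite (opposite M)); apply: moufang1_magma_loop.
- exact: magma_with_inverses_opposite.
- exact: moufang1_opposite.
Qed.

Lemma moufang1_loop_equations (M : baseUMagmaType) :
    loop M -> moufang1 M ->
  exists i, [/\ two_sided_inverse M i, moufang1 M & moufang2 M].
Proof.
move=> loopM m1; have [one _ _] := loopM.
have [i inv] := magma_with_inversesP _ (moufang1_loop_inverses _ loopM m1).
exists i; split=> //; apply: (moufang1_moufang2 _ i) => //.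
- exact: moufang1_lip.
- exact: moufang1_rip.
Qed.

Lemma moufang_loop_equations (M : baseUMagmaType) :
    moufang_loop M ->
  exists i, [/\ two_sided_inverse M i, moufang1 M & moufang2 M].
Proof.
case=> loopM m; have [one _ _] := loopM.
have from3 : moufang3 M ->
    exists i, [/\ two_sided_inverse M i, moufang1 M & moufang2 M].
  move=> m3; have [i [lip rip]] := moufang3_ip _ loopM m3.
  apply: moufang1_loop_equations => //; apply: (moufang4_moufang1 _ i) => //.
  exact/moufang34.
case: m => [m1|m2|m3|m4].
- exact: moufang1_loop_equations.
- have [|i [inv m1 m2']] := moufang1_loop_equations _ (loop_opposite _ loopM).
    exact: moufang1_opposite.
  exists i; split=> //; last exact: moufang1_of_opposite.
  by move=> x; have [xix ixx] := inv x.
- exact: from3.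
- by apply/from3/moufang34.
Qed.

Theorem theorem4p2 (M : baseUMagmaType) :
  [/\ magma_with_inverses M -> moufang1 M \/ moufang2 M -> moufang_loop M,
      moufang_loop M <->
        exists inv : M -> M,
          [/\ forall x : M, x * 1 = x /\ 1 * x = x,
              forall x : M, x * inv x = 1 /\ inv x * x = 1
            & forall x y z : M, ((x * y) * x) * z = x * (y * (x * z))]
    & moufang_loop M <->
        exists inv : M -> M,
          [/\ forall x : M, x * 1 = x /\ 1 * x = x,
              forall x : M, x * inv x = 1 /\ inv x * x = 1
            & forall x y z : M, x * (y * (z * y)) = ((x * y) * z) * y]].
Proof.
split; first exact: moufang_magma_loop.
- split=> [mloop|[i [one inv m1]]].
    have [i [inv m1 _]] := moufang_loop_equations _ mloop.
    by case: mloop => -[one _ _] _; exists i.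
  apply: moufang_magma_loop; last by left.
  by split=> // x; exists (i x).
- split=> [mloop|[i [one inv m2]]].
    have [i [inv _ m2]] := moufang_loop_equations _ mloop.
    by case: mloop => -[one _ _] _; exists i.
  apply: moufang_magma_loop; last by right.
  by split=> // x; exists (i x).
Qed.
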